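(* There exists an uncountable family of complete, discrete and countable metric spaces whose Lipschitz-free spaces are mutually non-isomorphic (i.e. for any two distinct members $M,N$ of the family, $\mathcal F(M)$ and $\mathcal F(N)$ are not linearly isomorphic).
   Context: A metric space is discrete if each of its points is isolated. Lipschitz-free space: for a metric space $M$ with a base point $0$, $\mathrm{Lip}_0(M)$ is the real Banach space of Lipschitz functions $f:M\to\mathbb R$ with $f(0)=0$, normed by the best Lipschitz constant; $\delta_M(x)\in \mathrm{Lip}_0(M)^*$ is evaluation at $x$, and $\mathcal F(M)$ is the norm-closed linear span of $\{\delta_M(x):x\in M\}$ in $\mathrm{Lip}_0(M)^*$ (independent of the base point up to linear isometry). Isomorphic means isomorphic via a bounded linear bijection with bounded inverse. *)

(* Defs.v *)
From HB Require Import structures.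
From mathcomp Require Import all_boot all_order all_algebra.
From mathcomp Require Import all_classical all_reals all_analysis.

Set Implicit Arguments.
Unset Strict Implicit.
Unset Printing Implicit Defensive.

Import Order.TTheory GRing.Theory Num.Theory.
Import numFieldNormedType.Exports.

Local Open Scope classical_set_scope.
Local Open Scope ring_scope.

(* `cvg F` is only available on pointed types, hence the explicit limit. *)
Definition complete_space (T : uniformType) : Prop :=
  forall F : set_system T, ProperFilter F -> cauchy F -> exists l : T, F --> l.

Definition all_isolated (T : topologicalType) : Prop :=
  forall x : T, isolated [set: T] x.

(* The library's `k.-lipschitz` requires a normed domain. *)
Definition lip_bounds (R : realType) (M : metricType R) (f : M -> R) : set R :=
  [set k | 0 <= k /\ forall x y, `|f x - f y| <= k * mdist x y].

Definition lip0_pred (R : realType) (M : metricType R) (x0 : M) :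
    {pred M -> R^o} :=
  mem [set f : M -> R^o | f x0 = 0 /\ lip_bounds f !=set0].

Record lip0 (R : realType) (M : metricType R) (x0 : M) := Lip0 {
  lip0_fun :> M -> R^o ;
  lip0_funP : lip0_fun \in lip0_pred x0 }.

Section Lip0Space.
Context (R : realType) (M : metricType R) (x0 : M).
Implicit Types f g : lip0 x0.

HB.instance Definition _ := [isSub for @lip0_fun R M x0].
HB.instance Definition _ := [Choice of lip0 x0 by <:].

Lemma lip_boundsD (f g : M -> R^o) (a b : R) :
  lip_bounds f a -> lip_bounds g b -> lip_bounds (f + g) (a + b).
Proof.
move=> [a0 fa] [b0 gb]; split; first exact: addr_ge0.
move=> x y; rewrite mulrDl.
apply: le_trans (lerD (fa x y) (gb x y)).
by rewrite opprD addrACA ler_normD.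
Qed.

Lemma lip_boundsZ (c : R) (f : M -> R^o) (a : R) :
  lip_bounds f a -> lip_bounds (c *: f) (`|c| * a).
Proof.
move=> [a0 fa]; split; first exact: mulr_ge0.
move=> x y; rewrite [X in `|X|](_ : _ = c * (f x - f y)); last first.
  by rewrite mulrBr.
by rewrite normrM -mulrA ler_wpM2l.
Qed.

Lemma lip0_submod_closed : submod_closed (lip0_pred x0).
Proof.
split.
  rewrite inE /=; split=> //; exists 0; split=> // x y.
  by rewrite mul0r subrr normr0.
move=> c f g /[!inE] -[f0 [a fa]] -[g0 [b gb]]; split.
  by rewrite /= [LHS](_ : _ = c * f x0 + g x0)// f0 g0 mulr0 addr0.
by exists (`|c| * a + b); apply: lip_boundsD => //; exact: lip_boundsZ.
Qed.

HB.instance Definition _ := GRing.isSubmodClosed.Build _ _ (lip0_pred x0)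
  lip0_submod_closed.
HB.instance Definition _ := [SubChoice_isSubLmodule of lip0 x0 by <:].

Definition lip_norm f : R := inf (lip_bounds f).

Lemma lip0_base f : f x0 = 0.
Proof. by have := lip0_funP f; rewrite inE => -[]. Qed.

Lemma lip_bounds_has_inf f : has_inf (lip_bounds f).
Proof.
split; first by have := lip0_funP f; rewrite inE => -[].
by exists 0 => k [].
Qed.

Lemma lip_norm_bounds f : lip_bounds f (lip_norm f).
Proof.
have [[k fk] lf] := lip_bounds_has_inf f.
split; first by apply: lb_le_inf => [|? []//]; exists k.
move=> x y; have [->|xy] := eqVneq x y.
  rewrite subrr normr0 mulr_ge0 ?mdist_ge0//.
  by apply: lb_le_inf => [|? []//]; exists k.
have d0 : 0 < mdist x y by rewrite mdist_gt0.
rewrite -ler_pdivrMr//; apply: lb_le_inf; first by exists k.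
by move=> j [_ /(_ x y)]; rewrite ler_pdivrMr.
Qed.

Lemma lip_norm_le f k : lip_bounds f k -> lip_norm f <= k.
Proof. by move=> fk; apply: ge_inf => //; exists 0 => j []. Qed.

Let lip_normD f g : lip_norm (f + g) <= lip_norm f + lip_norm g.
Proof. by apply/lip_norm_le/lip_boundsD; exact: lip_norm_bounds. Qed.

Let lip_normZ_le c f : lip_norm (c *: f) <= `|c| * lip_norm f.
Proof. by apply/lip_norm_le/lip_boundsZ; exact: lip_norm_bounds. Qed.

Let lip_normZ c f : lip_norm (c *: f) = `|c| * lip_norm f.
Proof.
apply/eqP; rewrite eq_le lip_normZ_le /=; have [->|c0] := eqVneq c 0.
  by rewrite normr0 mul0r; case: (lip_norm_bounds (0 *: f)).
have := lip_normZ_le c^-1 (c *: f).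
by rewrite scalerA mulVf// scale1r normfV ler_pdivlMl ?normr_gt0.
Qed.

Let lip_norm0_eq0 f : lip_norm f = 0 -> f = 0.
Proof.
move=> f0; apply/val_inj/funext => x.
have [_ /(_ x x0)] := lip_norm_bounds f.
by rewrite f0 mul0r lip0_base subr0 normr_le0 => /eqP.
Qed.

HB.instance Definition _ := Lmodule_isNormed.Build R (lip0 x0)
  lip_normD lip_normZ lip_norm0_eq0.

Lemma lip0_normE f : `|f| = lip_norm f. Proof. by []. Qed.

End Lip0Space.

Definition dual_pred (R : realType) (V : normedModType R) : {pred V -> R^o} :=
  mem [set phi : V -> R^o | scalar phi /\ continuous phi].
Arguments dual_pred {R} V phi : rename.

Record dual (R : realType) (V : normedModType R) := Dual {
  dual_fun :> V -> R^o ;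
  dual_funP : dual_fun \in dual_pred V }.

Section Dual.
Context (R : realType) (V : normedModType R).
Implicit Types phi psi : dual V.

HB.instance Definition _ := [isSub for @dual_fun R V].
HB.instance Definition _ := [Choice of dual V by <:].

Lemma dual_submod_closed : submod_closed (dual_pred V).
Proof.
split.
  rewrite inE /=; split; last by move=> x; exact: cvg_cst.
  by move=> a u v /=; rewrite [RHS](_ : _ = a * 0 + 0)// mulr0 addr0.
move=> c f g /[!inE] -[lf cf] -[lg cg]; split => /=.
  move=> a u v.
  rewrite [LHS](_ : _ = c * f (a *: u + v) + g (a *: u + v))//.
  rewrite [RHS](_ : _ = a * (c * f u + g u) + (c * f v + g v))//.
  by rewrite lf lg !mulrDr !mulrA addrACA [c * a]mulrC.
by move=> x; apply: cvgD (cg x); apply: cvgZr; exact: cf.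
Qed.

HB.instance Definition _ := GRing.isSubmodClosed.Build _ _ (dual_pred V)
  dual_submod_closed.
HB.instance Definition _ := [SubChoice_isSubLmodule of dual V by <:].

Definition dual_norm phi : R :=
  sup [set `|phi v| | v in [set v : V | `|v| <= 1]].

Lemma dual_linear phi : scalar phi.
Proof. by have := dual_funP phi; rewrite inE => -[]. Qed.

Lemma dual_continuous phi : continuous phi.
Proof. by have := dual_funP phi; rewrite inE => -[]. Qed.

Lemma dualD phi u v : phi (u + v) = phi u + phi v.
Proof. by have := dual_linear phi 1 u v; rewrite scale1r mul1r. Qed.

Lemma dual0 phi : phi 0 = 0.
Proof. by apply: (addrI (phi 0)); rewrite -dualD !addr0. Qed.

Lemma dualZ phi a v : phi (a *: v) = a * phi v.
Proof. by have := dual_linear phi a v 0; rewrite addr0 dual0 addr0. Qed.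

Lemma dual_bounded phi :
  exists2 k : R, 0 <= k & forall v, `|phi v| <= k * `|v|.
Proof.
pose h := GRing.isLinear.Build R V R^o *%R phi (dual_linear phi).
pose lphi : {linear V -> R^o} := HB.pack (phi : V -> R^o) h.
have /linear_bounded_continuous/linear_boundedP : continuous lphi.
  exact: dual_continuous.
by move=> /pinfty_ex_gt0[k k0 hk]; exists k => //; exact: ltW.
Qed.

Lemma dual_norm_has_sup phi :
  has_sup [set `|phi v| | v in [set v : V | `|v| <= 1]].
Proof.
split; first by exists `|phi 0|; exists 0 => //=; rewrite normr0.
have [k k0 hk] := dual_bounded phi; exists k => _ [v /= v1 <-].
by apply: le_trans (hk v) _; rewrite ler_piMr.
Qed.

Lemma dual_normP phi v : `|phi v| <= dual_norm phi * `|v|.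
Proof.
have [->|v0] := eqVneq v 0; first by rewrite dual0 !normr0 mulr0.
rewrite -ler_pdivrMr ?normr_gt0//.
apply: ub_le_sup; first by have [] := dual_norm_has_sup phi.
exists (`|v|^-1 *: v); first by rewrite /= normfZV.
by rewrite dualZ normrM normfV normr_id mulrC.
Qed.

Lemma dual_norm_le phi k : 0 <= k -> (forall v, `|phi v| <= k * `|v|) ->
  dual_norm phi <= k.
Proof.
move=> k0 hk; apply: ge_sup; first by have [] := dual_norm_has_sup phi.
by move=> _ [v /= v1 <-]; apply: le_trans (hk v) _; rewrite ler_piMr.
Qed.

Lemma dual_norm_ge0 phi : 0 <= dual_norm phi.
Proof.
apply: le_trans (normr_ge0 (phi 0)) _.
apply: ub_le_sup; first by have [] := dual_norm_has_sup phi.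
by exists 0 => //=; rewrite normr0.
Qed.

Let dual_normD phi psi : dual_norm (phi + psi) <= dual_norm phi + dual_norm psi.
Proof.
apply: dual_norm_le => [|v]; first by rewrite addr_ge0 ?dual_norm_ge0.
rewrite [X in `|X|](_ : _ = phi v + psi v)//.
by rewrite mulrDl (le_trans (ler_normD _ _))// lerD ?dual_normP.
Qed.

Let dual_normZ_le c phi : dual_norm (c *: phi) <= `|c| * dual_norm phi.
Proof.
apply: dual_norm_le => [|v]; first by rewrite mulr_ge0 ?dual_norm_ge0.
rewrite [X in `|X|](_ : _ = c * phi v)//.
by rewrite normrM -mulrA ler_wpM2l ?dual_normP.
Qed.

Let dual_normZ c phi : dual_norm (c *: phi) = `|c| * dual_norm phi.
Proof.
apply/eqP; rewrite eq_le dual_normZ_le /=; have [->|c0] := eqVneq c 0.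
  by rewrite normr0 mul0r dual_norm_ge0.
have := dual_normZ_le c^-1 (c *: phi).
by rewrite scalerA mulVf// scale1r normfV ler_pdivlMl ?normr_gt0.
Qed.

Let dual_norm0_eq0 phi : dual_norm phi = 0 -> phi = 0.
Proof.
move=> f0; apply/val_inj/funext => v.
by have := dual_normP phi v; rewrite f0 mul0r normr_le0 => /eqP.
Qed.

HB.instance Definition _ := Lmodule_isNormed.Build R (dual V)
  dual_normD dual_normZ dual_norm0_eq0.

Lemma dual_normE phi : `|phi| = dual_norm phi. Proof. by []. Qed.

End Dual.

Section Delta.
Context (R : realType) (M : metricType R) (x0 : M).

Lemma eval_dual (x : M) : (fun f : lip0 x0 => f x) \in dual_pred (lip0 x0).
Proof.
rewrite inE; pose h (f : lip0 x0) : R^o := f x.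
have lh : scalar h by [].
pose hl := GRing.isLinear.Build R (lip0 x0) R^o *%R h lh.
pose l : {linear lip0 x0 -> R^o} := HB.pack h hl.
split=> //; have : continuous l; last by [].
apply: bounded_linear_continuous; apply/linear_boundedP.
exists (mdist x x0); split=> [|r /ltW xr f]; first exact: num_real.
have [k0 /(_ x x0)] := lip_norm_bounds f.
rewrite lip0_base subr0 => /le_trans; apply.
by rewrite mulrC; exact: ler_wpM2r.
Qed.

Definition delta (x : M) : dual (lip0 x0) := Dual (eval_dual x).

End Delta.

Definition linear_span (R : realType) (V : lmodType R) (A : set V) : set V :=
  [set v | exists2 s : seq (R * V), {in s, forall p, A p.2} &
           v = \sum_(p <- s) p.1 *: p.2].

(* The closure is taken in the norm topology of the dual of Lip_0(M). *)
Definition lipfree_pred (R : realType) (M : metricType R) (x0 : M) :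
    {pred dual (lip0 x0)} :=
  mem (closure (linear_span (range (@delta R M x0)))).
Arguments lipfree_pred {R M} x0 phi : rename.

Record lipfree (R : realType) (M : metricType R) (x0 : M) := LipFree {
  lipfree_val :> dual (lip0 x0) ;
  lipfree_valP : lipfree_val \in lipfree_pred x0 }.

Section LipFree.
Context (R : realType) (M : metricType R) (x0 : M).
Implicit Types m n : lipfree x0.

HB.instance Definition _ := [isSub for @lipfree_val R M x0].
HB.instance Definition _ := [Choice of lipfree x0 by <:].

Lemma linear_span_submod (V : lmodType R) (A : set V) (c : R) (u v : V) :
  linear_span A u -> linear_span A v -> linear_span A (c *: u + v).
Proof.
move=> [s sA ->] [t tA ->]; exists ([seq (c * p.1, p.2) | p <- s] ++ t).
  move=> p; rewrite mem_cat => /orP[/mapP[q qs ->]/=|]; last exact: tA.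
  exact: sA.
rewrite big_cat big_map scaler_sumr; congr (_ + _).
by apply: eq_bigr => p _; rewrite scalerA.
Qed.

Lemma lipfree_submod_closed : submod_closed (lipfree_pred x0).
Proof.
split.
  by rewrite inE; apply: subset_closure; exists [::]; rewrite ?big_nil.
move=> c u v /[!inE] cu cv B Bn.
have : (c *: p.1 + p.2) @[p --> (u, v)] --> c *: u + v.
  by apply: cvgD; [apply: cvgZr; exact: cvg_fst|exact: cvg_snd].
move=> /(_ _ Bn) [[P Q] /= [Pu Qv] PQ].
have [p [pS Pp]] := cu _ Pu; have [q [qS Qq]] := cv _ Qv.
exists (c *: p + q); split; first exact: linear_span_submod.
exact: (PQ (p, q)).
Qed.

HB.instance Definition _ := GRing.isSubmodClosed.Build _ _ (lipfree_pred x0)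
  lipfree_submod_closed.
HB.instance Definition _ := [SubChoice_isSubLmodule of lipfree x0 by <:].

Let lipfree_norm m : R := `|lipfree_val m|.

Let lipfree_normD m n : lipfree_norm (m + n) <= lipfree_norm m + lipfree_norm n.
Proof. exact: ler_normD. Qed.

Let lipfree_normZ c m : lipfree_norm (c *: m) = `|c| * lipfree_norm m.
Proof. exact: normrZ. Qed.

Let lipfree_norm0_eq0 m : lipfree_norm m = 0 -> m = 0.
Proof. by move/normr0_eq0 => m0; exact: val_inj. Qed.

HB.instance Definition _ := Lmodule_isNormed.Build R (lipfree x0)
  lipfree_normD lipfree_normZ lipfree_norm0_eq0.

Lemma lipfree_normE m : `|m| = `|lipfree_val m|. Proof. by []. Qed.

End LipFree.

Definition bounded_operator (R : realType) (V W : normedModType R)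
    (T : V -> W) : Prop :=
  exists C : R, forall v, `|T v| <= C * `|v|.

Definition isomorphic (R : realType) (V W : normedModType R) : Prop :=
  exists (T : {linear V -> W}) (S : {linear W -> V}),
    [/\ cancel T S, cancel S T, bounded_operator T & bounded_operator S].

(* Main.v *)
From HB Require Import structures.
Require Import Defs.
From mathcomp Require Import all_boot all_order all_algebra.
From mathcomp Require Import all_classical all_reals all_analysis.
From mathcomp Require Import ring lra zify.
Import Order.TTheory GRing.Theory Num.Theory.
Import numFieldNormedType.Exports.
Set Implicit Arguments.
Unset Strict Implicit.
Unset Printing Implicit Defensive.
Local Open Scope classical_set_scope.
Local Open Scope ring_scope.

(** Dyadic subdivisions of the unit interval are glued along a well-founded
    tree [S] of finite sequences of integers: every node [s] carries a copy of
    the grid of mesh [2 ^- size s], and copies at nodes with a long common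
    prefix are close to each other ([tree_space]).  These spaces are countable
    and discrete; an infinite branch would create Cauchy sequences without
    limit, and well-foundedness forbids it ([tree_space_complete]).

    The free space of the unit interval is L_1, where the Rademacher functions
    have norm one and span a copy of l_2.  Hence every node [s] provides a
    finite sequence of vectors of norm at least one, indexed by the prefixes
    of [s], with an upper 2-estimate whose constant does not depend on [s]
    ([rademacher_norm_ge1], [rademacher_upper2]).

    There is no such infinite sequence: below a node, the space splits into
    uniformly separated pieces, namely single points and the parts below the
    children.  The free space then behaves like an l_1-sum over these pieces,
    and a gliding hump argument shows that a sequence with an upper 2-estimate
    tends to zero below a node as soon as it does below each of its children
    ([null_on_step]).  As the tree is well-founded, the sequence tends to zero
    in norm ([no_upper2_sequence]).

    Given countably many trees, take countable dense subsets of their free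
    spaces.  The finite sequences in these subsets which are bounded below and
    satisfy an upper 2-estimate can be coded as the nodes of one tree,
    [diagonal_tree], and this tree is well-founded by the previous paragraph.
    If its free space were isomorphic to one of the given ones, the images of
    its Rademacher vectors along a branch, slightly perturbed, would code a
    longer node; repeating this builds an infinite branch
    ([diagonal_not_isomorphic]).  So no countable family of trees exhausts the
    isomorphism classes, and one tree per class is the required family. *)

(** * Well-founded trees and the metric spaces attached to them *)

Record wf_tree := WFTree {
  nodes :> seq nat -> bool ;
  nodes_root : nodes [::] ;
  nodes_parent : forall s i, nodes (rcons s i) -> nodes s ;
  nodes_wf : forall g : nat -> nat, exists n, ~~ nodes (mkseq g n) }.

Section SequenceDistance.
Context (R : realType).
Implicit Types s t r : seq nat.

(** Sequences whose longest common prefix has length [n] are at distance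
    [4 ^- n].  The ratio 4 beats the number [2 ^ n] of intervals of the grid at
    depth [n]: moving that grid to a descendant changes a signed sum over its
    intervals by [O(2 ^- n)] only. *)
Fixpoint seq_dist s t : R :=
  match s, t with
  | [::], [::] => 0
  | i :: s', j :: t' => if i == j then seq_dist s' t' / 4 else 1
  | _, _ => 1
  end.

Lemma seq_dist_ge0 s t : 0 <= seq_dist s t.
Proof.
elim: s t => [|i s IH] [|j t] //=; case: ifP => // _.
by rewrite divr_ge0.
Qed.

Lemma seq_dist_le1 s t : seq_dist s t <= 1.
Proof.
elim: s t => [|i s IH] [|j t] //=; case: ifP => // _.
have := IH t; lra.
Qed.

Lemma seq_distxx s : seq_dist s s = 0.
Proof. by elim: s => //= i s ->; rewrite eqxx mul0r. Qed.

Lemma seq_distC s t : seq_dist s t = seq_dist t s.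
Proof. by elim: s t => [|i s IH] [|j t] //=; rewrite eq_sym IH. Qed.

Lemma seq_dist_triangle t s r : seq_dist s r <= seq_dist s t + seq_dist t r.
Proof.
have ge0 := seq_dist_ge0; have le1 := seq_dist_le1.
elim: s t r => [|i s IH] [|j t] [|k r] //=; rewrite ?addr0 ?add0r //; try lra.
- by case: ifP => _; have := ge0 t r; lra.
- by case: ifP => _; have := le1 s r; lra.
- by case: ifP => _; have := ge0 s t; lra.
have := (ge0 s t, ge0 t r, le1 s r, IH t r); move=> [[[]]] + + + +.
case: (eqVneq i j) => [->|ij]; first by case: ifP => _; lra.
case: (eqVneq j k) => [<-|jk]; first by rewrite (negbTE ij); lra.
by case: ifP => _; lra.
Qed.

Lemma inv4X_gt0 n : 0 < 4 ^- n :> R.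
Proof. by rewrite invr_gt0 exprn_gt0. Qed.

Lemma inv4X_le1 n : 4 ^- n <= 1 :> R.
Proof. by rewrite invf_le1 ?exprn_gt0// exprn_ege1//; lra. Qed.

Lemma seq_dist_lt s t n : seq_dist s t < 4 ^- n -> take n.+1 s = take n.+1 t.
Proof.
elim: n s t => [|n IH] [|i s] [|j t] //=; rewrite ?expr0 ?invr1 ?ltxx//.
- by case: eqP => [->|//]; rewrite ?take0 ?ltxx.
- by rewrite ltNge inv4X_le1.
- by rewrite ltNge inv4X_le1.
- case: eqP => [->|_]; last by rewrite ltNge inv4X_le1.
  by rewrite exprS invfM mulrC ltr_pM2l// => /IH ->.
Qed.

Lemma seq_dist_take s k : seq_dist (take k s) s <= 4 ^- k.
Proof.
elim: s k => [|i s IH] [|k] //=; rewrite ?expr0 ?invr1 ?invr_ge0 ?exprn_ge0//.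
by rewrite eqxx exprS invfM mulrC ler_pM2l.
Qed.

End SequenceDistance.

Lemma natr_dist_lt1 (R : realType) (i j : nat) :
  `|i%:R - j%:R : R| < 1 -> i = j.
Proof.
rewrite ltr_norml => /andP[ji ij].
have {}ji : (j < i.+1)%N by rewrite -(ltr_nat R) -natr1; lra.
have {}ij : (i < j.+1)%N by rewrite -(ltr_nat R) -natr1; lra.
by lia.
Qed.

(** The point [(s, j)] is the point [j / 2 ^ size s] of the copy of the unit
    interval at the node [s]. *)
Definition tree_space (R : realType) (S : wf_tree) : Type :=
  {x : seq nat * nat | S x.1 && (x.2 <= 2 ^ size x.1)%N}.

HB.instance Definition _ R S := Countable.on (@tree_space R S).

Section TreeSpace.
Context (R : realType) (S : wf_tree).
Local Notation M := (@tree_space R S).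
Implicit Types x y z : M.

Definition node x : seq nat := (val x).1.
Definition abscissa x : R := (val x).2%:R / 2 ^+ size (node x).

Lemma node_in x : S (node x). Proof. by have /andP[] := valP x. Qed.

Lemma abscissa_itv x : 0 <= abscissa x <= 1.
Proof.
rewrite /abscissa divr_ge0// ler_pdivrMr ?exprn_gt0// mul1r -natrX ler_nat.
by have /andP[] := valP x.
Qed.

Lemma tree_point_eq x y : node x = node y -> abscissa x = abscissa y -> x = y.
Proof.
rewrite /abscissa => e; rewrite -e => /divIf; rewrite expf_neq0// => /(_ isT).
move=> /eqP; rewrite eqr_nat => /eqP e2; apply: val_inj.
by move: e e2; rewrite /node; case: (val x) (val y) => [? ?] [? ?] /= -> ->.
Qed.

Definition tree_dist x y : R :=
  seq_dist R (node x) (node y) + `|abscissa x - abscissa y|.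

Let tree_distxx x : tree_dist x x = 0.
Proof. by rewrite /tree_dist seq_distxx subrr normr0 addr0. Qed.

Let tree_distC x y : tree_dist x y = tree_dist y x.
Proof. by rewrite /tree_dist seq_distC distrC. Qed.

Let tree_dist_triangle y x z : tree_dist x z <= tree_dist x y + tree_dist y z.
Proof.
rewrite /tree_dist addrACA lerD ?seq_dist_triangle//.
exact: ler_distD.
Qed.

(** Other nodes are at distance at least [4 ^- size s] from [s], and the other
    points at [s] are at distance at least [2 ^- size s]. *)
Lemma tree_dist_sep x y : tree_dist x y < 4 ^- size (node x) -> x = y.
Proof.
move=> xy; have e : node x = node y.
  have /seq_dist_lt : seq_dist R (node x) (node y) < 4 ^- size (node x).
    by apply: le_lt_trans xy; rewrite /tree_dist lerDl.
  rewrite take_oversize// => e.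
  have : (size (node y) <= size (node x))%N.
    rewrite leqNgt; apply/negP => lt; move/(congr1 size): e.
    by rewrite size_take; case: ltnP => h; lia.
  by move=> h; rewrite e take_oversize// ltnW.
apply: tree_point_eq => //; move: xy.
rewrite /tree_dist e seq_distxx add0r /abscissa e -mulrBl normrM.
set n := size _; rewrite normfV normrX normr_nat ltr_pdivrMr ?exprn_gt0//.
move=> h; have {h} : `|(val x).2%:R - (val y).2%:R : R| < 1.
  apply: (lt_le_trans h).
  rewrite mulrC -exprVn -exprMn exprn_ile1//; lra.
by move/natr_dist_lt1 ->.
Qed.

Let tree_dist_eq0 x y : tree_dist x y = 0 -> x = y.
Proof. by move=> e; apply: tree_dist_sep; rewrite e invr_gt0 exprn_gt0. Qed.

HB.instance Definition _ := isMetric.Build R M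
  tree_distxx tree_dist_eq0 tree_distC tree_dist_triangle.

Lemma tree_mdistE x y : mdist x y = tree_dist x y. Proof. by []. Qed.

Lemma tree_space_isolated : all_isolated M.
Proof.
move=> x; split; first by rewrite inE.
exists (ball x (4 ^- size (node x))).
  by apply: nbhsx_ballx; rewrite invr_gt0 exprn_gt0.
apply/seteqP; split=> y /=; last by move=> ->; split=> //; apply: ballxx; rewrite invr_gt0 exprn_gt0.
by rewrite ballEmdist => -[/= /tree_dist_sep ->].
Qed.

Lemma tree_space_countable : countable [set: M].
Proof. exact: countableP. Qed.

Lemma nodes_take s k : S s -> S (take k s).
Proof.
elim/last_ind: s => [//|s i IH] Ss.
have [ks|ks] := leqP k (size s).
  by rewrite -cats1 takel_cat//; apply/IH/nodes_parent/Ss.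
by rewrite take_oversize// size_rcons.
Qed.

(** A Cauchy filter concentrates on the points below a node of each depth.
    Either some small ball is reduced to its centre, which is then the limit,
    or these nodes form an infinite branch. *)
Lemma tree_space_complete : complete_space M.
Proof.
move=> F PF /cauchyP cF; apply: contrapT => ncv.
have ball_node n x y : ball x (4 ^- n) y -> take n.+1 (node x) = take n.+1 (node y).
  rewrite ballEmdist /= => xy; apply: seq_dist_lt; apply: le_lt_trans xy.
  by rewrite tree_mdistE lerDl.
have /choice[x Fx] n : exists x, F (ball x (4 ^- n)).
  by apply: cF; exact: inv4X_gt0.
have size_x n : (n < size (node (x n)))%N.
  rewrite ltnNge; apply/negP => sn; apply: ncv; exists (x n).
  move=> A /nbhs_singleton Ax; apply: filterS (Fx n) => y.
  rewrite ballEmdist /= => xy; suff <- : x n = y by [].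
  apply: tree_dist_sep; apply: (lt_le_trans xy).
  by rewrite lef_pV2 ?posrE ?exprn_gt0// ler_eXn2l//; lra.
have coherent m n : (m <= n)%N -> nth 0%N (node (x m)) m = nth 0%N (node (x n)) m.
  move=> mn.
have [y [/ball_node my /ball_node ny]] := filter_ex (filterI (Fx m) (Fx n)).
  rewrite -(nth_take _ (ltnSn m)) my -(@nth_take n.+1 _ _ m _ (node (x n)))// ny.
  by rewrite !nth_take.
have [n] := nodes_wf S (fun n => nth 0%N (node (x n)) n).
suff -> : mkseq (fun n => nth 0%N (node (x n)) n) n = take n (node (x n)).
  by rewrite nodes_take// node_in.
apply: (@eq_from_nth _ 0%N) => [|i]; rewrite size_mkseq.
  by rewrite size_takel// ltnW.
by move=> lin; rewrite nth_mkseq// nth_take// (coherent _ n)// ltnW.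
Qed.

End TreeSpace.

(** * Elements of Lipschitz-free spaces *)

Section LipschitzFree.
Context (R : realType) (M : metricType R) (o : M).
Implicit Types (f g : lip0 o) (m : lipfree o).

Lemma lip0_lipschitz f x y : `|f x - f y| <= `|f| * mdist x y.
Proof. by have [_] := lip_norm_bounds f; apply. Qed.

Lemma lip0_build (h : M -> R) (k : R) : 0 <= k -> h o = 0 ->
  (forall x y, `|h x - h y| <= k * mdist x y) ->
  exists2 f : lip0 o, (forall x, f x = h x) & `|f| <= k.
Proof.
move=> k0 ho hk; have hP : (h : M -> R^o) \in lip0_pred o.
  by rewrite inE /=; split=> //; exists k; split.
exists (Lip0 hP) => //; exact: lip_norm_le.
Qed.

Lemma lip0_eq f g : (forall x, f x = g x) -> f = g.
Proof. by move=> fg; apply/val_inj/funext. Qed.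

Lemma lip0_zeroE x : (0 : lip0 o) x = 0. Proof. by []. Qed.

Lemma lip0_oppE f x : (- f) x = - f x. Proof. by []. Qed.

Lemma lip0_addE f g x : (f + g) x = f x + g x. Proof. by []. Qed.

Lemma lip0_scaleE a f x : (a *: f) x = a * f x. Proof. by []. Qed.

Lemma free_evalD m f g : m (f + g) = m f + m g.
Proof. exact: dualD. Qed.

Lemma free_evalZ m a f : m (a *: f) = a * m f.
Proof. exact: dualZ. Qed.

Lemma eval_freeD m n f : (m + n) f = m f + n f. Proof. by []. Qed.

Lemma eval_freeZ a m f : (a *: m) f = a * m f. Proof. by []. Qed.

Lemma eval_freeB m n f : (m - n) f = m f - n f. Proof. by []. Qed.

Lemma eval_free_sum (I : Type) (r : seq I) (P : pred I) (u : I -> lipfree o) f :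
  (\sum_(i <- r | P i) u i) f = \sum_(i <- r | P i) u i f.
Proof.
exact: (big_morph (fun m : lipfree o => m f) (fun _ _ => erefl) erefl).
Qed.

Lemma free_eval_le m f : `|m f| <= `|m| * `|f|.
Proof. exact: dual_normP. Qed.

Lemma free_norm_le m k : 0 <= k -> (forall f, `|m f| <= k * `|f|) -> `|m| <= k.
Proof. exact: dual_norm_le. Qed.

Lemma free_delta_subproof x : delta o x \in lipfree_pred o.
Proof.
rewrite inE; apply: subset_closure; exists [:: (1, delta o x)].
  by move=> p; rewrite inE => /eqP -> /=; exists x.
by rewrite big_seq1 scale1r.
Qed.

Definition free_delta x : lipfree o := LipFree (free_delta_subproof x).

Lemma free_deltaE x f : free_delta x f = f x. Proof. by []. Qed.

Definition combination (s : seq (R * M)) : lipfree o :=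
  \sum_(p <- s) p.1 *: free_delta p.2.

Lemma combinationE s f : combination s f = \sum_(p <- s) p.1 * f p.2.
Proof. by rewrite eval_free_sum. Qed.

Lemma combination_dense m eps : 0 < eps -> exists s, `|m - combination s| < eps.
Proof.
move=> eps0; have := lipfree_valP m; rewrite inE => /(_ (ball (lipfree_val m) eps)).
move=> /(_ (nbhsx_ballx _ _ eps0))[v [[s sd ->]]].
rewrite -ball_normE /= => ms.
have [t ts] : exists t : seq (R * M),
    \sum_(p <- s) p.1 *: p.2 = \sum_(p <- t) p.1 *: delta o p.2.
  elim: s sd {ms} => [|p s IH] sd; first by exists [::]; rewrite !big_nil.
  have [|t ts] := IH; first by move=> q qs; apply: sd; rewrite inE qs orbT.
  have [|x _ xp] := sd p; first by rewrite inE eqxx.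
  by exists ((p.1, x) :: t); rewrite !big_cons ts xp.
exists t; rewrite lipfree_normE.
suff -> : lipfree_val (m - combination t) =
  lipfree_val m - \sum_(p <- s) p.1 *: p.2 by [].
rewrite ts; apply/val_inj/funext => f /=.
rewrite -[LHS]/((m - combination t) f) eval_freeB combinationE.
congr (_ - _); elim: t {ts} => [|p t IH]; first by rewrite !big_nil.
by rewrite !big_cons IH.
Qed.

End LipschitzFree.

Lemma free_delta_dist (R : realType) (M : metricType R) (o x y : M) :
  `|free_delta o x - free_delta o y| <= mdist x y.
Proof.
apply: free_norm_le => [|f]; first exact: mdist_ge0.
by rewrite eval_freeB !free_deltaE mulrC lip0_lipschitz.
Qed.

(** A bounded functional on the free space, here evaluation at [f] composed
    with [T], is evaluation at a Lipschitz function. *)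
Lemma free_transpose (R : realType) (M N : metricType R) (o : M) (p : N)
    (T : {linear lipfree o -> lipfree p}) (C : R) (f : lip0 p) : 0 <= C ->
  (forall m, `|T m| <= C * `|m|) ->
  exists2 g : lip0 o, `|g| <= C * `|f| & forall x, g x = T (free_delta o x) f.
Proof.
move=> C0 TC; have [|||g gE gC] := @lip0_build _ _ o (fun x => T (free_delta o x) f) (C * `|f|).
- by rewrite mulr_ge0.
- rewrite (_ : free_delta o o = 0) ?linear0//.
  by do 2!apply: val_inj; apply/funext => h; exact: lip0_base.
- move=> x y; rewrite -eval_freeB -linearB.
  apply: (le_trans (free_eval_le _ _)); rewrite mulrAC ler_wpM2r//.
  apply: (le_trans (TC _)); rewrite ler_wpM2l//; exact: free_delta_dist.
by exists g.
Qed.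

Section Separability.
Context (R : realType) (M : metricType R) (o : M).

Lemma countable_surjection (T : Type) (x0 : T) : countable [set: T] ->
  exists h : nat -> T, forall x, exists n, h n = x.
Proof.
move=> /pcard_injP[/= g inj].
exists (fun n => if pselect (exists x, g x = n) is left e then projT1 (cid e) else x0).
move=> x; exists (g x); case: pselect => [e|[]]; last by exists x.
by apply: inj; rewrite ?inE//; case: (cid e).
Qed.

Lemma lipfree_separable : countable [set: M] ->
  exists e : nat -> lipfree o, forall m eps, 0 < eps ->
    exists n, `|m - e n| < eps.
Proof.
move=> /(countable_surjection o)[h hs].
pose q (c : seq (rat * nat)) := combination o [seq (ratr p.1, h p.2) | p <- c].
exists (fun n => if unpickle n is Some c then q c else 0) => m eps eps0.
have eps2 : 0 < eps / 2 by rewrite divr_gt0.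
have [s ms] := combination_dense m eps2.
suff [c cs] : exists c, `|combination o s - q c| < eps / 2.
  exists (pickle c); rewrite pickleK.
  rewrite (splitr eps) (le_lt_trans _ (ltrD ms cs))// -{1}(subrKA (combination o s)).
  exact: ler_normD.
elim: s (eps / 2) eps2 {ms} => [|p s IH] {eps0}d d0.
  by exists [::]; rewrite /q /combination !big_nil subrr normr0.
have d2 : 0 < d / 2 by rewrite divr_gt0.
have [c cs] := IH _ d2; have [k hk] := hs p.2.
pose w := `|free_delta o p.2| + 1.
have w0 : 0 < w by rewrite ltr_wpDl.
have : p.1 - d / 2 / w < p.1 + d / 2 / w.
  by rewrite ltrD2l gtrN// divr_gt0.
move=> /rat_in_itvoo[r]; rewrite in_itv /= -ltr_distlC => rp.
exists ((r, k) :: c); rewrite /q /combination /= !big_cons /= hk.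
rewrite opprD addrACA -scalerBl (splitr d).
apply: (le_lt_trans (ler_normD _ _)); apply: ltr_leD (ltW cs).
rewrite normrZ; apply: (@le_lt_trans _ _ (`|p.1 - ratr r| * w)).
  by rewrite ler_wpM2l// lerDl.
by rewrite -ltr_pdivlMr// distrC.
Qed.

End Separability.

(** * Rademacher vectors *)

Section Rademacher.
Context (R : realType).

Lemma cross_sum_le (T : Type) (r : seq T) (x : T -> R) (y : R) :
  2 * y * \sum_(i <- r) x i <=
    \sum_(i <- r) x i ^+ 2 + (size r)%:R * y ^+ 2.
Proof.
elim: r => [|i r IH] /=; first by rewrite !big_nil mulr0 mul0r addr0.
rewrite !big_cons -natr1 mulrDl mul1r mulrDr; have := sqr_ge0 (x i - y); nra.
Qed.

Lemma sqr_sum_le (T : Type) (r : seq T) (x : T -> R) :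
  (\sum_(i <- r) x i) ^+ 2 <= (size r)%:R * \sum_(i <- r) x i ^+ 2.
Proof.
elim: r => [|i r IH] /=; first by rewrite !big_nil expr0n mul0r.
rewrite !big_cons -natr1; have := cross_sum_le r x (x i); nra.
Qed.

Lemma sqr_le_sqr (x y : R) : `|x| <= y -> x ^+ 2 <= y ^+ 2.
Proof.
move=> xy; rewrite -(real_normK (num_real x)).
by rewrite ler_sqr ?nnegrE ?(le_trans _ xy).
Qed.

Lemma sum_even_odd (F : nat -> R) N :
  \sum_(0 <= j < N.*2) F j = \sum_(0 <= j < N) (F j.*2 + F j.*2.+1).
Proof.
elim: N => [|N IH]; first by rewrite !big_nil.
by rewrite doubleS !big_nat_recr//= IH addrA.
Qed.

(** If [g j] is the value at [j / 2 ^ n] of a Lipschitz function, this is the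
    integral of its derivative against the [n]-th Rademacher function. *)
Definition alt_sum n (g : nat -> R) : R :=
  \sum_(0 <= j < 2 ^ n) (-1) ^+ j * (g j.+1 - g j).

(** Bessel's inequality for the orthonormal Rademacher functions.  Passing from
    depth [n.+1] to depth [n] replaces two consecutive increments [x] and [y]
    by [x + y], and the Rademacher function lost is paired with [x - y]: the
    induction rests on [(x + y) ^+ 2 + (x - y) ^+ 2 = 2 * (x ^+ 2 + y ^+ 2)]. *)
Lemma haar_energy n (g : nat -> R) :
  \sum_(0 <= k < n.+1) alt_sum k (fun j => g (j * 2 ^ (n - k))%N) ^+ 2
    <= 2 ^+ n * \sum_(0 <= i < 2 ^ n) (g i.+1 - g i) ^+ 2.
Proof.
elim: n g => [|n IH] g.
  by rewrite /alt_sum !big_nat1 expr0 !mul1r !muln1.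
pose h i := g i.*2.
have coarse : \sum_(0 <= k < n.+1) alt_sum k (fun j => g (j * 2 ^ (n.+1 - k))%N) ^+ 2 =
    \sum_(0 <= k < n.+1) alt_sum k (fun j => h (j * 2 ^ (n - k))%N) ^+ 2.
  apply: eq_big_nat => k /andP[_ kn]; congr (alt_sum _ _ ^+ 2).
  by apply/funext => j; rewrite subSn// expnS mulnCA mul2n.
have fine : alt_sum n.+1 (fun j => g (j * 2 ^ (n.+1 - n.+1))%N) ^+ 2 <=
    2 ^+ n * \sum_(0 <= j < 2 ^ n)
      ((g j.*2.+1 - g j.*2) - (g j.*2.+2 - g j.*2.+1)) ^+ 2.
  have -> : alt_sum n.+1 (fun j => g (j * 2 ^ (n.+1 - n.+1))%N) =
    \sum_(0 <= j < 2 ^ n) ((g j.*2.+1 - g j.*2) - (g j.*2.+2 - g j.*2.+1)).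
    rewrite /alt_sum expnS mul2n sum_even_odd; apply: eq_bigr => j _.
    rewrite subnn !muln1 -signr_odd odd_double expr0 mul1r.
    by rewrite -signr_odd /= odd_double expr1 mulN1r.
  by apply: (le_trans (sqr_sum_le _ _)); rewrite size_iota subn0 natrX.
rewrite big_nat_recr// coarse.
apply: (le_trans (lerD (IH h) fine)).
rewrite -mulrDr -big_split/= exprSr -mulrA ler_wpM2l ?exprn_ge0//.
rewrite expnS mul2n sum_even_odd mulr_sumr ler_sum// => j _.
by rewrite /h doubleS; lra.
Qed.

(** The distance to the even integers below [N.*2], capped at 1. *)
Fixpoint tent N (x : R) : R :=
  if N is N'.+1 then Num.min (tent N' x) `|x - N'.*2%:R| else 1.

Lemma tent_lipschitz N x y : `|tent N x - tent N y| <= `|x - y|.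
Proof.
elim: N => [|N IH] /=; first by rewrite subrr normr0.
have : `| `|x - N.*2%:R| - `|y - N.*2%:R| | <= `|x - y|.
  by apply: le_trans (ler_dist_dist _ _) _; rewrite opprB addrA subrK.
move: IH; rewrite !ler_norml => /andP[a b] /andP[c d].
by case: (leP (tent N x)); case: (leP (tent N y)) => ? ?; apply/andP; split; lra.
Qed.

Lemma tent_odd N j : (j < N.*2)%N -> tent N j%:R = (odd j)%:R.
Proof.
elim: N => // N IH jN /=.
have [jN'|Nj] := ltnP j N.*2.
  rewrite IH//; apply/min_idPl.
  rewrite distrC ger0_norm ?subr_ge0 ?ler_nat 1?ltnW//.
  rewrite lerBrDr -natrD ler_nat; case: (odd j) => /=; lia.
have tent1 M x : 0 <= tent M x <= 1.
  elim: M => [|M /andP[a b]] /=; first by rewrite ler01 lexx.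
  by rewrite le_min a normr_ge0 /= ge_min b.
have tentN M : (M.*2 <= j)%N -> odd j -> tent M j%:R = 1.
  elim: M => // M IHM Mj oj /=; rewrite IHM//; last by lia.
  apply/min_idPl; rewrite ger0_norm ?subr_ge0 ?ler_nat//; last by lia.
  by rewrite lerBrDr nat1r ler_nat; lia.
have [jd|jd] : j = N.*2 \/ j = N.*2.+1 by lia.
  rewrite jd subrr normr0 odd_double; apply/min_idPr.
  by have /andP[] := tent1 N N.*2%:R.
rewrite jd /= odd_double /= -jd tentN//; last by rewrite jd /= odd_double.
by rewrite jd -nat1r addrK normr1 minxx.
Qed.

Lemma sum_inv4X n : \sum_(0 <= k < n) 4 ^- k <= 4 / 3 :> R.
Proof.
suff -> : \sum_(0 <= k < n) 4 ^- k = 4 / 3 - 4 / 3 * 4 ^- n :> R.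
  by rewrite gerBl mulr_ge0// invr_ge0 exprn_ge0.
elim: n => [|n IH]; first by rewrite big_nil expr0 invr1 mulr1 subrr.
rewrite big_nat_recr//= IH exprS invfM; lra.
Qed.

Variable S : wf_tree.
Local Notation M := (@tree_space R S).

Lemma tree_root_subproof : S [::] && (0 <= 2 ^ 0)%N.
Proof. by rewrite nodes_root. Qed.

Definition tree_root : M :=
  exist (fun x : seq nat * nat => S x.1 && (x.2 <= 2 ^ size x.1)%N)
    ([::], 0%N) tree_root_subproof.

Definition tree_point s j : M := insubd tree_root (s, j).

Lemma tree_pointK s j : S s -> (j <= 2 ^ size s)%N -> val (tree_point s j) = (s, j).
Proof. by move=> Ss js; rewrite /tree_point insubdK// unfold_in /= Ss. Qed.

Lemma node_point s j : S s -> (j <= 2 ^ size s)%N -> node (tree_point s j) = s.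
Proof. by move=> Ss js; rewrite /node tree_pointK. Qed.

Lemma abscissa_point s j : S s -> (j <= 2 ^ size s)%N ->
  abscissa (tree_point s j) = j%:R / 2 ^+ size s :> R.
Proof. by move=> Ss js; rewrite /abscissa node_point// tree_pointK. Qed.

Lemma abscissa_root : abscissa tree_root = 0 :> R.
Proof. by rewrite /abscissa mul0r. Qed.

(** Under the identification of the free space of the unit interval with L_1,
    the difference of the evaluations at the end points of an interval is the
    indicator function of this interval. *)
Definition rademacher s : lipfree tree_root :=
  \sum_(0 <= j < 2 ^ size s) (-1) ^+ j *:
    (free_delta tree_root (tree_point s j.+1) - free_delta tree_root (tree_point s j)).

Lemma rademacherE s f :
  rademacher s f = alt_sum (size s) (fun j => f (tree_point s j)).
Proof. by rewrite eval_free_sum. Qed.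

(** The vector is tested on a saw-tooth function whose slope has the sign of the
    Rademacher function. *)
Lemma rademacher_norm_ge1 s : S s -> 1 <= `|rademacher s|.
Proof.
move=> Ss; set n := size s.
have n0 : 0 < 2 ^+ n :> R by rewrite exprn_gt0.
pose h (x : M) := tent (2 ^ n).+1 (2 ^+ n * abscissa x) / 2 ^+ n.
have h0 : h tree_root = 0.
  by rewrite /h abscissa_root mulr0 (tent_odd (j := 0)) ?mul0r.
have hlip x y : `|h x - h y| <= 1 * mdist x y.
  rewrite mul1r tree_mdistE /h -mulrBl normrM normfV (ger0_norm (ltW n0)).
  rewrite ler_pdivrMr//; apply: (le_trans (tent_lipschitz _ _ _)).
  rewrite -mulrBr normrM (ger0_norm (ltW n0)) mulrC ler_wpM2r ?(ltW n0)//.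
  by rewrite /tree_dist lerDr seq_dist_ge0.
have [f fE f1] := lip0_build ler01 h0 hlip.
have := free_eval_le (rademacher s) f.
suff -> : rademacher s f = 1.
  by rewrite normr1 => /le_trans; apply; rewrite ler_piMr.
rewrite rademacherE /alt_sum -/n.
have -> : \sum_(0 <= j < 2 ^ n) (-1) ^+ j * (f (tree_point s j.+1) - f (tree_point s j)) =
    \sum_(0 <= j < 2 ^ n) (2 ^+ n)^-1.
  apply: eq_big_nat => j /andP[_ jn]; rewrite !fE /h !abscissa_point -/n//; last exact: ltnW.
  rewrite ![2 ^+ n * _]mulrC !divfK ?gt_eqF// !tent_odd; [|lia|lia].
  by rewrite -mulrBl mulrA -signr_odd /=; case: (odd j); rewrite /= ?expr1 ?expr0; lra.
by rewrite sumr_const_nat subn0 -[LHS]mulr_natr natrX mulVf ?gt_eqF.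
Qed.

Lemma dist_prolongation s k j : S s -> (k <= size s)%N -> (j <= 2 ^ k)%N ->
  mdist (tree_point (take k s) j) (tree_point s (j * 2 ^ (size s - k))) <= 4 ^- k :> R.
Proof.
move=> Ss ks jk; have Sk : S (take k s) by exact: nodes_take.
have jn : (j * 2 ^ (size s - k) <= 2 ^ size s)%N.
  by rewrite -{2}(subnKC ks) expnD leq_mul2r jk orbT.
have jk' : (j <= 2 ^ size (take k s))%N by rewrite size_takel.
rewrite tree_mdistE /tree_dist !node_point// !abscissa_point// size_takel//.
have -> : 2 ^+ size s = 2 ^+ k * 2 ^+ (size s - k) :> R by rewrite -exprD subnKC.
rewrite natrM natrX invfM mulrACA divff ?expf_neq0//.
by rewrite mulr1 subrr normr0 addr0 seq_dist_take.
Qed.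

(** Moving all the points involved to the copy of the interval at the node [s]
    changes the [k]-th term by at most [2 * `|f| / 2 ^+ k], and there
    [haar_energy] applies.  The constant bounds [2 + 8 * (4 / 3)]. *)
Lemma rademacher_upper2 s f : S s ->
  \sum_(0 <= k < (size s).+1) rademacher (take k s) f ^+ 2 <= 13 * `|f| ^+ 2.
Proof.
move=> Ss; set n := size s.
pose g i := f (tree_point s i).
pose B k := alt_sum k (fun j => g (j * 2 ^ (n - k))%N).
have near k : (k <= n)%N -> `|rademacher (take k s) f - B k| <= 2 * `|f| / 2 ^+ k.
  move=> kn; rewrite rademacherE size_takel// /B /alt_sum -sumrB.
  apply: (le_trans (ler_norm_sum _ _ _)).
  have -> : 2 * `|f| / 2 ^+ k = \sum_(0 <= j < 2 ^ k) 2 * `|f| / 4 ^+ k.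
    rewrite sumr_const_nat subn0 -[RHS]mulr_natr natrX.
    rewrite -[4]/(2 * 2)%:R natrM exprMn invfM.
    by field; rewrite expf_neq0.
  rewrite !big_nat; apply: ler_sum => j /andP[_ jk].
  rewrite -mulrBr normrM normrX normrN1 expr1n mul1r.
  have close i : (i <= 2 ^ k)%N ->
      `|f (tree_point (take k s) i) - g (i * 2 ^ (n - k))%N| <= `|f| / 4 ^+ k.
    move=> ik; apply: (le_trans (lip0_lipschitz _ _ _)).
    by rewrite ler_wpM2l// dist_prolongation.
  rewrite [X in `|X|](_ : _ = (f (tree_point (take k s) j.+1) - g (j.+1 * 2 ^ (n - k))%N)
     - (f (tree_point (take k s) j) - g (j * 2 ^ (n - k))%N)); last by ring.
  apply: (le_trans (ler_normB _ _)).
  by have := close _ jk; have := close _ (ltnW jk); lra.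
have energy : \sum_(0 <= k < n.+1) B k ^+ 2 <= `|f| ^+ 2.
  apply: (le_trans (haar_energy _ _)).
  have -> : `|f| ^+ 2 = 2 ^+ n * \sum_(0 <= i < 2 ^ n) (`|f| / 2 ^+ n) ^+ 2.
    rewrite sumr_const_nat subn0 -[X in _ = _ * X]mulr_natr natrX.
    by field; rewrite expf_neq0.
  rewrite ler_wpM2l ?exprn_ge0// !big_nat ler_sum// => i /andP[_ il].
  apply: sqr_le_sqr.
  apply: (le_trans (lip0_lipschitz _ _ _)); rewrite ler_wpM2l//.
  rewrite tree_mdistE /tree_dist !node_point ?abscissa_point ?(ltnW il)//.
  rewrite seq_distxx add0r -mulrBl -natr1 addrAC subrr add0r mul1r ger0_norm//.
apply: (@le_trans _ _ (\sum_(0 <= k < n.+1) (2 * B k ^+ 2 + 8 * `|f| ^+ 2 * 4 ^- k))).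
  rewrite !big_nat; apply: ler_sum => k /andP[_ kn].
  have := near k kn.
  have -> : 4 ^- k = (2 ^- k) ^+ 2 :> R.
    by rewrite -[4]/(2 * 2)%:R natrM exprMn invfM expr2.
  set x := rademacher _ _; set y := B k; set t := 2 ^- k.
  move=> /sqr_le_sqr; rewrite -/t !exprMn.
  have := sqr_ge0 (x - 2 * y); nra.
rewrite big_split/= -!mulr_sumr; have := sum_inv4X n.+1; have := energy.
have := sqr_ge0 `|f|; nra.
Qed.

End Rademacher.

(** * Bounded below sequences with an upper 2-estimate *)

(** By duality, this says that the norm of any combination of the first [n]
    terms of [u] is at most [Num.sqrt C] times the l_2-norm of its
    coefficients. *)
Definition upper2 (R : realType) (M : metricType R) (o : M) (C : R)
    (u : nat -> lipfree o) (n : nat) :=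
  forall f, \sum_(0 <= k < n) u k f ^+ 2 <= C * `|f| ^+ 2.

Section NoUpper2.
Context (R : realType) (S : wf_tree).
Local Notation M := (@tree_space R S).
Local Notation o := (tree_root R S).
Implicit Types (s : seq nat) (x y : M).

(** The pieces of the part of the space below [s]: the points at the node [s],
    numbered from 0 to [2 ^ size s], then the parts below its children. *)
Definition piece s x : nat :=
  if node x == s then (val x).2 else ((2 ^ size s).+1 + nth 0 (node x) (size s))%N.

(** Test functions for the part of the space below [s].  Lipschitz continuity is
    only required inside a piece, so that such functions can be glued freely
    along pieces; this is what makes the free space an l_1-sum. *)
Record admissible s (h : M -> R) : Prop := Admissible {
  adm_out : forall x, ~~ prefix s (node x) -> h x = 0 ;
  adm_le2 : forall x, `|h x| <= 2 ;
  adm_lip : forall x y, prefix s (node x) -> prefix s (node y) ->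
    piece s x = piece s y -> `|h x - h y| <= mdist x y }.

(** Distinct pieces below [s] are separated by [4 ^- size s], also from the
    rest of the space. *)
Lemma same_piece s x y : tree_dist x y < 4 ^- size s ->
  prefix s (node x) -> prefix s (node y) /\ piece s x = piece s y.
Proof.
move=> xy px.
have e : take (size s).+1 (node x) = take (size s).+1 (node y).
  by apply: (@seq_dist_lt R); apply: le_lt_trans xy; rewrite lerDl.
have py : prefix s (node y).
  rewrite prefixE -(take_takel _ (leqnSn _)) -e take_takel//.
  by rewrite -prefixE.
split=> //; rewrite /piece.
case: eqVneq => [ex|nx].
  by rewrite -(tree_dist_sep (x := x) (y := y)) ?ex ?eqxx// ex.
case: eqVneq => [ey|ny].
  have ed : tree_dist y x = tree_dist x y by rewrite /tree_dist seq_distC distrC.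
  by case/eqP: nx; rewrite -(tree_dist_sep (x := y) (y := x)) ?ey ?ed.
by congr (_ + _)%N; rewrite -(nth_take _ (ltnSn _)) e nth_take.
Qed.

Lemma prefix_child s j x : prefix (rcons s j) (node x) =
  prefix s (node x) && (piece s x == (2 ^ size s).+1 + j)%N.
Proof.
have [/prefixP[t et]|npx] /= := boolP (prefix s (node x)); last first.
  apply: contraNF npx; apply: prefix_trans; exact: prefix_rcons.
have /andP[_] := valP x; rewrite -/(node x) /piece et.
case: t et => [|k t] et; rewrite ?cats0 ?eqxx.
  move=> xs; rewrite ltn_eqF ?ltnS ?(leq_trans xs) ?leq_addr//.
  by apply/negbTE; apply/negP => /size_prefix; rewrite size_rcons ltnn.
have -> : s ++ k :: t == s = false.
  by apply/eqP => /(congr1 size); rewrite size_cat /=; lia.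
move=> _; rewrite eqn_add2l nth_cat ltnn subnn -cats1 prefixE /= size_cat /= addn1.
by rewrite take_cat ltnNge leqnSn /= subSnn /= take0 eqseq_cat// eqxx /= eqseq_cons eqxx andbT.
Qed.

Lemma val_piece s x i : prefix s (node x) -> piece s x = i ->
  (i <= 2 ^ size s)%N -> val x = (s, i).
Proof.
rewrite /piece /node => _; case: (val x) => t j /=.
by case: eqVneq => [-> -> //|_]; lia.
Qed.

Lemma indicator_lip0 x : x != o ->
  exists f : lip0 o, forall y, f y = (y == x)%:R.
Proof.
move=> xo; have far y : y != x -> 1 <= 4 ^+ size (node x) * mdist x y.
  move=> yx; rewrite -ler_pdivrMl ?exprn_gt0// mulr1 leNgt.
  by apply: contra yx => /tree_dist_sep ->.
have [|||f fE _] := @lip0_build _ _ o (fun y => (y == x)%:R : R) (4 ^+ size (node x)).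
- by rewrite exprn_ge0.
- by rewrite eq_sym (negbTE xo).
- move=> y z; case: (eqVneq y x) => [->|yx]; case: (eqVneq z x) => [->|zx].
  + by rewrite subrr normr0 mulr_ge0// ?exprn_ge0// mdist_ge0.
  + by rewrite subr0 normr1 far.
  + by rewrite sub0r normrN normr1 metric_sym far.
  + by rewrite subrr normr0 mulr_ge0// ?exprn_ge0// mdist_ge0.
by exists f.
Qed.

(** Gluing along separated pieces costs a constant that depends on [s] only. *)
Lemma admissible_lipschitz s h x y : admissible s h ->
  `|h x - h y| <= 4 * 4 ^+ size s * mdist x y.
Proof.
move=> [out le2 lip].
have c1 : 1 <= 4 ^+ size s :> R by rewrite exprn_ege1//; lra.
have [far|close] := leP (4 ^- size s) (tree_dist x y).
  have big : 4 <= 4 * 4 ^+ size s * mdist x y.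
    rewrite -mulrA ler_peMr// -ler_pdivrMl ?mulr1//; lra.
  apply: le_trans big; apply: (le_trans (ler_normB _ _)).
  by have := le2 x; have := le2 y; lra.
have d0 : 0 <= mdist x y by exact: mdist_ge0.
have [px|npx] := boolP (prefix s (node x)).
  have [py xy] := same_piece close px.
  by apply: (le_trans (lip _ _ px py xy)); nra.
have [py|npy] := boolP (prefix s (node y)); last first.
  by rewrite !out// subrr normr0; nra.
have close' : tree_dist y x < 4 ^- size s.
  by move: close; rewrite /tree_dist seq_distC distrC.
by have [px] := same_piece close' py; rewrite px in npx.
Qed.

Lemma admissible_norm s (f : lip0 o) : admissible s f -> `|f| <= 4 * 4 ^+ size s.
Proof.
move=> af; apply: lip_norm_le; split; first by rewrite mulr_ge0// exprn_ge0.
by move=> x y; exact: admissible_lipschitz.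
Qed.

Lemma admissible_glue s (f g : lip0 o) (P : pred nat) :
  admissible s f -> admissible s g ->
  exists2 h : lip0 o, admissible s h &
    forall x, h x = if P (piece s x) then f x else g x.
Proof.
move=> [outf le2f lipf] [outg le2g lipg].
pose h x : R := if P (piece s x) then f x else g x.
have ah : admissible s h.
  split=> [x px|x|x y px py xy]; rewrite /h.
  - by case: ifP => _; [exact: outf|exact: outg].
  - by case: ifP.
  - by rewrite xy; case: ifP => _; [exact: lipf|exact: lipg].
have [|||F FE _] := @lip0_build _ _ o h (4 * 4 ^+ size s).
- by rewrite mulr_ge0// exprn_ge0.
- by rewrite /h !lip0_base if_same.
- by move=> x y; exact: admissible_lipschitz.
by exists F => //; split=> [x|x|x y]; rewrite !FE; case: ah => ? ? ?; auto.
Qed.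

Lemma admissible0 s : admissible s (0 : lip0 o).
Proof.
by split=> [x _|x|x y _ _ _]; rewrite !lip0_zeroE ?subrr ?normr0// mdist_ge0.
Qed.

Lemma admissibleN s (f : lip0 o) : admissible s f -> admissible s (- f).
Proof.
move=> [out le2 lip]; split=> [x px|x|x y px py xy]; rewrite !lip0_oppE.
- by rewrite out// oppr0.
- by rewrite normrN.
- by rewrite -opprD normrN lip.
Qed.

(** A vector of the free space is a limit of finitely supported ones, and a
    finite set of points meets finitely many pieces. *)
Lemma admissible_tail s (m : lipfree o) eps : 0 < eps -> exists N,
  forall f : lip0 o, admissible s f -> (forall x, (piece s x < N)%N -> f x = 0) ->
    `|m f| <= eps.
Proof.
move=> eps0; pose L : R := 4 * 4 ^+ size s.
have L0 : 0 < L by rewrite mulr_gt0// exprn_gt0.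
have [t mt] := combination_dense m (divr_gt0 eps0 L0).
exists (\max_(p <- t) (piece s p.2)).+1 => f af fN.
have -> : m f = (m - combination o t) f.
  rewrite eval_freeB combinationE big1_seq ?subr0// => p /andP[_ pt].
  by rewrite fN ?mulr0// ltnS; apply: (leq_bigmax_seq (F := fun p => piece s p.2)).
apply: (le_trans (free_eval_le _ _)); rewrite -(divfK (lt0r_neq0 L0) eps).
by rewrite ler_pM// ?(ltW mt)// admissible_norm.
Qed.

Context (u : nat -> lipfree o) (C : R).
Hypothesis u_upper2 : forall n, upper2 C u n.

Lemma upper2_weakly_null (f : lip0 o) eps : 0 < eps ->
  exists N, forall n, (N <= n)%N -> `|u n f| <= eps.
Proof.
move=> eps0; have cv : cvgn (series (fun n => (u n f : R) ^+ 2)).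
  apply: nondecreasing_is_cvgn.
    by apply: nondecreasing_series => n _ _; exact: sqr_ge0.
  by exists (C * `|f| ^+ 2) => _ [n _ <-]; exact: u_upper2.
have /cvgrPdist_le := cvg_series_cvg_0 cv.
move=> /(_ (eps ^+ 2) (exprn_gt0 _ eps0))[N _ hN]; exists N => n Nn.
have := hN n Nn; rewrite /= sub0r normrN normrX.
by rewrite ler_sqr ?nnegrE// ltW.
Qed.

Definition null_on s := forall eps, 0 < eps ->
  exists N, forall n, (N <= n)%N -> forall f : lip0 o, admissible s f -> `|u n f| <= eps.

(** On the part below a child this is the hypothesis; on a single point, test
    functions are multiples of one indicator function. *)
Lemma null_on_piece s i eps : (forall j, null_on (rcons s j)) -> 0 < eps ->
  exists N, forall n, (N <= n)%N -> forall f : lip0 o, admissible s f ->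
    (forall x, piece s x != i -> f x = 0) -> `|u n f| <= eps.
Proof.
move=> child eps0; have [lis|lsi] := leqP i (2 ^ size s); last first.
  have [j ij] : exists j, i = ((2 ^ size s).+1 + j)%N.
    by exists (i - (2 ^ size s).+1)%N; rewrite subnKC.
  have [N hN] := child j _ eps0.
  exists N => n Nn f [out le2 lip] fi; apply: hN => //.
  split=> [x|//|x y]; rewrite !prefix_child -ij.
    by rewrite negb_and => /orP[/out|/fi].
  by move=> /andP[px /eqP ix] /andP[py /eqP iy] _; apply: lip; rewrite ?ix.
pose p := tree_point R S s i.
have fp (f : lip0 o) : admissible s f -> (forall x, piece s x != i -> f x = 0) ->
    forall x, f x = f p * (x == p)%:R.
  move=> [out _ _] fi x; case: eqP => [->|xp]; rewrite ?mulr1 ?mulr0//.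
  have [px|/out//] := boolP (prefix s (node x)).
  have [ix|/fi//] := eqVneq (piece s x) i.
  have ex := val_piece px ix lis.
  have Ss : S s by have := node_in x; rewrite /node ex.
  by case: xp; apply: val_inj; rewrite ex tree_pointK.
have [po|po] := eqVneq p o.
  exists 0%N => n _ f af fi; rewrite (_ : f = 0) ?dual0 ?normr0 ?ltW//.
  by apply: lip0_eq => x; rewrite (fp f)// po lip0_base mul0r.
have [chi chiE] := indicator_lip0 po.
have [N hN] := upper2_weakly_null chi (divr_gt0 eps0 (ltr0n R 2)).
exists N => n Nn f af fi; rewrite (_ : f = f p *: chi).
  rewrite free_evalZ normrM; have := hN n Nn; have := adm_le2 af p.
  have := normr_ge0 (u n chi); nra.
by apply: lip0_eq => x; rewrite lip0_scaleE chiE -fp.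
Qed.

Lemma null_on_head s N eps : (forall j, null_on (rcons s j)) -> 0 < eps ->
  exists n0, forall n, (n0 <= n)%N -> forall f : lip0 o, admissible s f ->
    (forall x, (N <= piece s x)%N -> f x = 0) -> `|u n f| <= eps.
Proof.
move=> child; elim: N eps => [|N IH] eps eps0.
  exists 0%N => n _ f _ f0; rewrite (_ : f = 0).
    by rewrite dual0 normr0 ltW.
  by apply: lip0_eq => x; rewrite f0.
have eps2 : 0 < eps / 2 by rewrite divr_gt0.
have [n1 h1] := IH _ eps2; have [n2 h2] := null_on_piece N child eps2.
exists (maxn n1 n2) => n; rewrite geq_max => /andP[n1n n2n] f af f0.
have [g ag gE] := admissible_glue (fun i => i < N)%N af (admissible0 s).
have [h ah hE] := admissible_glue (fun i => i == N)%N af (admissible0 s).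
rewrite (_ : f = g + h); last first.
  apply: lip0_eq => x; rewrite lip0_addE gE hE.
  by case: ltngtP => xN; rewrite ?addr0 ?add0r// f0.
rewrite free_evalD (splitr eps); apply: (le_trans (ler_normD _ _)); apply: lerD.
  by apply: h1 => // x; rewrite gE leqNgt => /negbTE ->.
by apply: h2 => // x /negbTE; rewrite hE => ->.
Qed.

(** Gliding hump.  Otherwise the vectors [u n] keep a mass [eps] below [s], which
    escapes from any finite set of pieces.  Selecting [m] of them with almost
    disjoint supports and gluing the functions that norm them gives an
    admissible function on which their sum is at least [m * (eps / 2)], while
    the upper 2-estimate only allows a multiple of [Num.sqrt m]. *)
Lemma null_on_step s : (forall j, null_on (rcons s j)) -> null_on s.
Proof.
move=> child; apply: contrapT => /existsNP[eps /not_implyP[eps0 notnull]].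
have hump n0 : exists n (h : lip0 o), [/\ (n0 <= n)%N, admissible s h & eps < u n h].
  move/forallNP : notnull => /(_ n0) /existsNP[n /not_implyP[n0n]].
  move=> /existsNP[h /not_implyP[ah /negP]]; rewrite -ltNge => hn.
  have [p|p] := leP 0 (u n h).
    by exists n, h; split=> //; rewrite ger0_norm in hn.
  exists n, (- h); split=> //; first exact: admissibleN.
  by rewrite -scaleN1r free_evalZ mulN1r -ltr0_norm.
have eps8 : 0 < eps / 8 by rewrite divr_gt0.
(* The partial sums of squares are kept in the invariant, in a form that is
   linear in [v], because the norm of [v] alone would not survive the addition
   of a new term; the optimal [a] recovers the l_2-estimate for [v]. *)
have glide m : exists (v : lipfree o) (f : lip0 o) (b : nat),
  [/\ admissible s f, m%:R * (eps / 2) <= v f &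
   forall (g : lip0 o) a, 2 * a * v g <= \sum_(0 <= k < b) u k g ^+ 2 + m%:R * a ^+ 2].
  elim: m => [|m [v [f [b [af vf vg]]]]].
    exists 0, 0, 0%N; split; first exact: admissible0.
      by rewrite mul0r.
    by move=> g a; rewrite big_nil mul0r addr0 mulr0.
  have [N tail] := admissible_tail s v eps8.
  have [n1 head] := null_on_head N child eps8.
  have [n [h [bn ah hn]]] := hump (maxn b n1).
  move: bn; rewrite geq_max => /andP[bn n1n].
  have [fl afl flE] := admissible_glue (fun i => i < N)%N af (admissible0 s).
  have [fr afr frE] := admissible_glue (fun i => i < N)%N (admissible0 s) af.
  have [hl ahl hlE] := admissible_glue (fun i => i < N)%N ah (admissible0 s).
  have [hr ahr hrE] := admissible_glue (fun i => i < N)%N (admissible0 s) ah.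
  have [k ak kE] := admissible_glue (fun i => i < N)%N af ah.
  have ef : f = fl + fr.
    by apply: lip0_eq => x; rewrite lip0_addE flE frE; case: ifP; rewrite ?addr0 ?add0r.
  have eh : h = hl + hr.
    by apply: lip0_eq => x; rewrite lip0_addE hlE hrE; case: ifP; rewrite ?addr0 ?add0r.
  have ek : k = fl + hr.
    by apply: lip0_eq => x; rewrite lip0_addE kE flE hrE; case: ifP; rewrite ?addr0 ?add0r.
  (* The head of [f], where [v] lives, is glued to the tail of the hump [h]; the
     four error terms below cost at most half of [eps]. *)
  exists (v + u n), k, n.+1; split=> //.
    have vfr : `|v fr| <= eps / 8 by apply: tail => // x xN; rewrite frE xN.
    have vhr : `|v hr| <= eps / 8 by apply: tail => // x xN; rewrite hrE xN.
    have ufl : `|u n fl| <= eps / 8.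
      by apply: head => // x; rewrite flE leqNgt => /negbTE ->.
    have uhl : `|u n hl| <= eps / 8.
      by apply: head => // x; rewrite hlE leqNgt => /negbTE ->.
    move: vf hn; rewrite ef eh ek eval_freeD !free_evalD -(natr1 m).
    move: vfr vhr ufl uhl; rewrite !ler_norml.
    move=> /andP[? ?] /andP[? ?] /andP[? ?] /andP[? ?]; lra.
  move=> g a; rewrite eval_freeD big_nat_recr//= -(natr1 m).
  have : \sum_(0 <= j < b) u j g ^+ 2 <= \sum_(0 <= j < n) u j g ^+ 2.
    rewrite (@big_cat_nat _ _ _ b 0 n)//= lerDl sumr_ge0// => j _; exact: sqr_ge0.
  have := vg g a; have := sqr_ge0 (u n g - a); nra.
pose L : R := 4 * 4 ^+ size s.
pose q := (eps / 2) ^+ 2.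
have q0 : 0 < q by rewrite exprn_gt0// divr_gt0.
have [v [f [b [af vf vg]]]] := glide (Num.truncn (`|C| * L ^+ 2 / q)).+1.
move: vf vg; set m := _%:R => vf vg.
have mq : `|C| * L ^+ 2 < m * q by rewrite -ltr_pdivrMr// truncnS_gt.
have : 2 * (m * q) <= C * `|f| ^+ 2 + m * q.
  apply: le_trans (le_trans (vg f (eps / 2)) (lerD (u_upper2 b f) (lexx _))).
  by have := eps0; rewrite /q; nra.
have : C * `|f| ^+ 2 <= `|C| * L ^+ 2.
  apply: (@le_trans _ _ (`|C| * `|f| ^+ 2)).
    by rewrite ler_wpM2r ?exprn_ge0// ler_norm.
  by rewrite ler_wpM2l// ler_sqr ?nnegrE ?admissible_norm// mulr_ge0// exprn_ge0.
lra.
Qed.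

Lemma null_on_out s : ~~ S s -> null_on s.
Proof.
move=> Ss eps eps0; exists 0%N => n _ f [out _ _].
rewrite (_ : f = 0) ?dual0 ?normr0 ?ltW//; apply: lip0_eq => x.
rewrite out//; apply: contra Ss; rewrite prefixE => /eqP <-.
exact/nodes_take/node_in.
Qed.

(** By [null_on_step], a node where the sequence does not tend to zero has a
    child with the same property, and following such children never stops. *)
Lemma null_on_root : null_on [::].
Proof.
apply: contrapT => not0.
have /choice[next nextP] s : exists i, ~ null_on s -> ~ null_on (rcons s i).
  apply: contrapT => /forallNP H; have [s0|s0] := pselect (null_on s).
    by apply: (H 0%N).
  by apply: s0; apply: null_on_step => i; apply: contrapT => si; apply: (H i).
pose b := fix b n := if n is n'.+1 then rcons (b n') (next (b n')) else [::].
have bP n : ~ null_on (b n) by elim: n => // n IH; exact: nextP.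
have [n] := nodes_wf S (fun n => next (b n)).
suff -> : mkseq (fun n => next (b n)) n = b n by move=> /null_on_out /(bP n).
by elim: n => // n IH; rewrite mkseqS IH.
Qed.

(** Up to normalization every Lipschitz function is admissible at the root. *)
Lemma no_upper2_sequence c : 0 < c -> ~ (forall n, c <= `|u n|).
Proof.
move=> c0 uc; have c2 : 0 < c / 2 by rewrite divr_gt0.
have [N hN] := null_on_root c2.
suff : `|u N| <= c / 2 by have := uc N; lra.
apply: free_norm_le => [|f]; first exact: ltW.
have [->|f0] := eqVneq f 0; first by rewrite dual0 !normr0 mulr0.
have nf0 : 0 < `|f| by rewrite normr_gt0.
pose g := `|f|^-1 *: f.
have glip x y : `|g x - g y| <= mdist x y.
  by have := lip0_lipschitz g x y; rewrite /g normfZV ?mul1r.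
have ag : admissible [::] g.
  split=> [x|x|x y _ _ _]; [by rewrite prefix0s| |exact: glip].
  have := glip x o; rewrite lip0_base subr0 tree_mdistE /tree_dist => /le_trans; apply.
  rewrite -[2]/(1 + 1) lerD ?seq_dist_le1// abscissa_root subr0 ger0_norm.
    by have /andP[] := abscissa_itv x.
  by have /andP[] := abscissa_itv x.
have := hN N (leqnn N) g ag.
by rewrite /g free_evalZ normrM normfV normr_id ler_pdivrMl// mulrC.
Qed.

End NoUpper2.

(** * Diagonalizing over countably many trees *)

Section Isomorphism.
Context (R : realType).
Implicit Types V W Z : normedModType R.

Lemma isomorphic_sym V W : isomorphic V W -> isomorphic W V.
Proof. by move=> [T [S [TS ST bT bS]]]; exists S, T. Qed.

Lemma bounded_operator_ge0 V W (T : V -> W) : bounded_operator T ->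
  exists2 C : R, 0 <= C & forall v, `|T v| <= C * `|v|.
Proof.
move=> [C bT]; exists `|C| => // v.
by apply: (le_trans (bT v)); rewrite ler_wpM2r// ler_norm.
Qed.

Lemma bounded_operator_comp V W Z (T : V -> W) (U : W -> Z) :
  bounded_operator T -> bounded_operator U -> bounded_operator (U \o T).
Proof.
move=> [C bT] /bounded_operator_ge0[D D0 bU]; exists (D * C) => v /=.
by apply: (le_trans (bU _)); rewrite -mulrA ler_wpM2l.
Qed.

Lemma isomorphic_trans V W Z : isomorphic V W -> isomorphic W Z -> isomorphic V Z.
Proof.
move=> [T [S [TS ST bT bS]]] [T' [S' [TS' ST' bT' bS']]].
pose U : {linear V -> Z} := T' \o T.
pose U' : {linear Z -> V} := S \o S'.
exists U, U'; split; [exact: can_comp|exact: can_comp| |]; exact: bounded_operator_comp.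
Qed.

End Isomorphism.

Section Diagonal.
Context (R : realType) (F : nat -> wf_tree).

(** The sequence [c] lists indices of vectors in the dense sequence [e k]. *)
Definition upper2_code (e : forall k, nat -> lipfree (tree_root R (F k))) k (C : nat) (c : seq nat) : Prop :=
  (forall i, (i < size c)%N -> 1 <= C%:R * `|e k (nth 0%N c i)|) /\
  upper2 C%:R (fun i => e k (nth 0%N c i)) (size c).

(** The first entry of a node codes the space where the sequence lives and the
    constant of its estimates. *)
Definition diagonal (e : forall k, nat -> lipfree (tree_root R (F k))) (s : seq nat) : bool :=
  if s is a :: c then
    if unpickle a is Some (k, C) then `[< upper2_code e k C c >] else false
  else true.

Lemma diagonal_parent e s i : diagonal e (rcons s i) -> diagonal e s.
Proof.
case: s => [//|a c] /=; case: (unpickle a) => [[k C]|//] /asboolP[lower upper].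
apply/asboolP; split=> [j jc|f].
  by have := lower j; rewrite size_rcons nth_rcons jc; apply; exact: ltnW.
apply: le_trans (upper f); rewrite size_rcons big_nat_recr//=.
rewrite [X in X <= _](_ : _ = \sum_(0 <= j < size c) e k (nth 0%N (rcons c i) j) f ^+ 2).
  by rewrite lerDl sqr_ge0.
by apply: eq_big_nat => j /andP[_ jc]; rewrite nth_rcons jc.
Qed.

Lemma mkseq_cons (g : nat -> nat) n :
  mkseq g n.+1 = g 0%N :: mkseq (g \o succn) n.
Proof. by rewrite /mkseq /= -[1%N]addn0 iotaDl -map_comp. Qed.

(** An infinite branch would code a sequence excluded by
    [no_upper2_sequence]. *)
Lemma diagonal_wf e (g : nat -> nat) : exists n, ~~ diagonal e (mkseq g n).
Proof.
apply: contrapT => /forallNP all; have {}all n : diagonal e (mkseq g n).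
  by apply/negPn/negP; exact: all.
have := all 1%N; rewrite /mkseq /=; case ga : (unpickle (g 0%N)) => [[k C]|//] _.
have code n : upper2_code e k C (mkseq (g \o succn) n).
  by have := all n.+1; rewrite mkseq_cons /= ga => /asboolP.
have lower n : 1 <= C%:R * `|e k (g n.+1)|.
  by have [+ _] := code n.+1 => /(_ n); rewrite size_mkseq nth_mkseq//; apply.
have C0 : 0 < C%:R :> R.
  by rewrite lt0r ler0n andbT; apply/eqP => C0; have := lower 0%N; rewrite C0 mul0r ler10.
apply: (@no_upper2_sequence _ _ (fun n => e k (g n.+1)) C%:R _ (C%:R^-1)).
- move=> n f; have [_ /(_ f)] := code n; rewrite size_mkseq; apply: le_trans.
  by rewrite big_nat [leRHS]big_nat ler_sum// => i /andP[_ lin]; rewrite nth_mkseq.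
- by rewrite invr_gt0.
- by move=> n; rewrite -[leLHS]mulr1 ler_pdivrMl.
Qed.

Definition diagonal_tree e : wf_tree :=
  WFTree (nodes := diagonal e) isT (@diagonal_parent e) (@diagonal_wf e).

End Diagonal.

Lemma upper2_image (R : realType) (S : wf_tree) (N : metricType R) (p : N)
    (T : {linear lipfree (tree_root R S) -> lipfree p}) (C : R) s : 0 <= C ->
  (forall m, `|T m| <= C * `|m|) -> S s -> 
  upper2 (13 * C ^+ 2) (fun k => T (rademacher R S (take k s))) (size s).+1.
Proof.
move=> C0 TC Ss f; have [g gC gE] := free_transpose f C0 TC.
have Tg t : T (rademacher R S t) f = rademacher R S t g.
  rewrite rademacherE linear_sum eval_free_sum; apply: eq_bigr => j _.
  by rewrite linearZ linearB eval_freeZ eval_freeB !gE.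
under eq_bigr do rewrite Tg.
apply: (le_trans (rademacher_upper2 _ Ss)).
by rewrite -mulrA -exprMn ler_wpM2l// ler_sqr ?nnegrE// mulr_ge0.
Qed.

(** A node of the diagonal tree gives, through the isomorphism, the images of
    the Rademacher vectors at its prefixes; they are bounded below and satisfy
    an upper 2-estimate.  Appending to the node the index of an element of the
    dense sequence close to the last of these images yields a longer node. *)
Lemma diagonal_not_isomorphic (R : realType) (F : nat -> wf_tree)
    (e : forall k, nat -> lipfree (tree_root R (F k))) :
  (forall k m eps, 0 < eps -> exists n, `|m - e k n| < eps) ->
  forall k, ~ isomorphic (lipfree (tree_root R (diagonal_tree e)))
                         (lipfree (tree_root R (F k))).
Proof.
move=> dense k [T [U [TU _ /bounded_operator_ge0[A A0 bT] /bounded_operator_ge0[B B0 bU]]]].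
set D := diagonal_tree e in T U TU bT bU *.
pose w s := T (rademacher R D s).
pose K := B + 1; have K0 : 0 < K by rewrite ltr_wpDl.
have wlow s : D s -> 1 <= K * `|w s|.
  move=> /rademacher_norm_ge1 /le_trans -> //.
  rewrite -{1}(TU (rademacher R D s)); apply: (le_trans (bU _)).
  by rewrite ler_wpM2r// lerDl.
(* The factor [(2 * K)^-1] preserves half of the lower bound, and the factor
   [2 ^- n] makes the squared errors summable. *)
pose d n : R := (2 * K)^-1 / 2 ^+ n.
have d0 n : 0 < d n by rewrite divr_gt0 ?exprn_gt0// invr_gt0 mulr_gt0.
have /choice[code codeP] s : exists c, `|w s - e k c| < d (size s).
  exact: dense.
pose C := (Num.truncn (26 * A ^+ 2 + 3 + 2 * K)).+1.
have CA : 26 * A ^+ 2 + 3 + 2 * K < C%:R by exact: truncnS_gt.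
pose a := pickle (k, C).
pose b := fix b n := if n is n'.+1 then rcons (b n') (code (b n')) else [:: a].
have sizeb n : size (b n) = n.+1 by elim: n => //= n IH; rewrite size_rcons IH.
have bE n : b n = a :: mkseq (fun i => code (b i)) n.
  by elim: n => //= n {1}->; rewrite mkseqS.
have takeb i n : (i <= n)%N -> take i.+1 (b n) = b i.
  elim: n => [|n IH]; first by rewrite leqn0 => /eqP ->.
  rewrite leq_eqVlt => /orP[/eqP ->|]; first by rewrite take_oversize ?sizeb.
  by rewrite ltnS => lin; rewrite /= -cats1 takel_cat ?sizeb// IH.
have Db n : D (b n).
  elim: n => [|n IH].
    rewrite /= pickleK; apply/asboolP; split=> // f; rewrite big_nil.
    by rewrite mulr_ge0// exprn_ge0.
  have Dbi i : (i <= n)%N -> D (b i).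
    by move=> lin; rewrite -(takeb i n lin) nodes_take.
  rewrite bE /= pickleK; apply/asboolP; split.
    rewrite size_mkseq => i lin; rewrite nth_mkseq//.
    have := ltW (codeP (b i)); have := wlow (b i) (Dbi i lin).
    have dK : K * d (size (b i)) <= 1 / 2.
      rewrite -ler_pdivlMl// mulrC mul1r -invfM mulrC (mulrC K).
      by rewrite ler_pdivrMr ?exprn_gt0// ler_peMr ?exprn_ege1 ?ler1n// invr_ge0 ltW// mulr_gt0.
    have : `|w (b i)| <= `|w (b i) - e k (code (b i))| + `|e k (code (b i))|.
      by rewrite -{1}(subrK (e k (code (b i))) (w (b i))) ler_normD.
    have e0 := normr_ge0 (e k (code (b i))).
    have C2 : 2 * K <= C%:R by have := sqr_ge0 A; move: CA; lra.
    have := ler_wpM2r e0 C2; nra.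
  rewrite size_mkseq => f.
  have near i : (i < n.+1)%N -> e k (code (b i)) f ^+ 2 <=
      2 * (w (take i.+1 (b n)) f) ^+ 2 + 2 * `|f| ^+ 2 * 4 ^- i.
    rewrite ltnS => lin; rewrite takeb//.
    have dX : d (size (b i)) ^+ 2 <= 4 ^- i.
      have : d (size (b i)) <= 2 ^- i.
        rewrite sizeb /d exprS [(2 * 2 ^+ i)^-1]invfM mulrA ler_piMl ?invr_ge0 ?exprn_ge0//.
        by rewrite -invfM invf_le1 ?mulr_gt0// /K; move: B0; lra.
      have -> : 4 ^- i = (2 ^- i) ^+ 2 :> R.
        by rewrite -[4]/(2 * 2)%:R natrM exprMn invfM expr2.
      by move=> dle; rewrite ler_sqr ?nnegrE// ?ltW ?invr_gt0 ?exprn_gt0.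
    have := le_trans (free_eval_le (w (b i) - e k (code (b i))) f)
      (ler_wpM2r (normr_ge0 f) (ltW (codeP (b i)))).
    move=> /sqr_le_sqr; rewrite eval_freeB exprMn.
    have := sqr_ge0 `|f|; set x := w _ _; set y := e _ _ _.
    have := sqr_ge0 (y - 2 * x); nra.
  apply: (@le_trans _ _ (\sum_(0 <= i < n.+1)
      (2 * (w (take i.+1 (b n)) f) ^+ 2 + 2 * `|f| ^+ 2 * 4 ^- i))).
    rewrite !big_nat ler_sum// => i /andP[_ lin].
    by rewrite nth_mkseq// near.
  rewrite big_split/= -!mulr_sumr.
  have := upper2_image A0 bT IH f; rewrite sizeb big_nat_recl//= -/(w _).
  have f2 := sqr_ge0 `|f|; have := ler_wpM2l f2 (sum_inv4X R n.+1).
  have := sqr_ge0 (w (take 0 (b n)) f).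
  have C3 : 26 * A ^+ 2 + 3 <= C%:R by move: CA K0; lra.
  have := ler_wpM2r f2 C3; lra.
pose g i := if i is j.+1 then code (b j) else a.
have [[|n]] := nodes_wf D g; first by rewrite nodes_root.
by rewrite mkseq_cons -[_ :: _]/(a :: mkseq (fun i => code (b i)) n) -bE Db.
Qed.

Lemma root_tree_wf (g : nat -> nat) : exists n, ~~ pred1 [::] (mkseq g n).
Proof. by exists 1%N. Qed.

Definition root_tree : wf_tree.
Proof.
by exists (pred1 [::]) => [//|[|? ?] ? //|]; exact: root_tree_wf.
Defined.

Theorem corollary4p6 (R : realType) :
  exists (I : Type) (M : I -> metricType R) (o : forall i : I, M i),
    [/\ ~ countable [set: I],
        forall i : I, complete_space (M i),
        forall i : I, all_isolated (M i),
        forall i : I, countable [set: M i]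
      & forall i j : I, i <> j -> ~ isomorphic (lipfree (o i)) (lipfree (o j))].
Proof.
pose iso S S' := isomorphic (lipfree (tree_root R S)) (lipfree (tree_root R S')).
(* The indices are the isomorphism classes, each with a chosen tree. *)
pose I := {P : set wf_tree | exists S, P = iso S}.
pose rep (i : I) := projT1 (cid (proj2_sig i)).
have repP i : proj1_sig i = iso (rep i) := projT2 (cid (proj2_sig i)).
have refl S : iso S S.
  by exists idfun, idfun; split=> //; exists 1 => v; rewrite mul1r.
exists I, (fun i => tree_space R (rep i)), (fun i => tree_root R (rep i)); split.
- pose i0 : I := exist _ (iso root_tree) (ex_intro _ root_tree erefl).
  move=> /(countable_surjection i0)[h hs].
  pose F n := rep (h n).
  have sep n : exists e : nat -> lipfree (tree_root R (F n)),
      forall m eps, 0 < eps -> exists k, `|m - e k| < eps.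
    by apply: lipfree_separable; exact: tree_space_countable.
  pose e n := projT1 (cid (sep n)).
  have dense n : forall m eps, 0 < eps -> exists k, `|m - e n k| < eps := projT2 (cid (sep n)).
  pose i : I := exist _ (iso (diagonal_tree e)) (ex_intro _ (diagonal_tree e) erefl).
  have [k hk] := hs i; apply: (diagonal_not_isomorphic dense (k := k)).
  have : iso (diagonal_tree e) = iso (rep i) := repP i.
  by rewrite -/(iso _ _) /F hk => ->; exact: refl.
- by move=> i; exact: tree_space_complete.
- by move=> i; exact: tree_space_isolated.
- by move=> i; exact: tree_space_countable.
- move=> i j ij isoij; apply: ij.
  suff : proj1_sig i = proj1_sig j.
    by case: (i) (j) => [P p] [Q q] /=; exact: eq_exist.
  rewrite !repP.
  apply/seteqP; split=> S; rewrite /iso => iS; last exact: isomorphic_trans isoij iS.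
  exact: isomorphic_trans (isomorphic_sym isoij) iS.
Qed.
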